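(* Let $D$ be a combinatorial data structure. Limits of convergent sequences coincide with $\mathrm{eSYM}(D)$: for every convergent sequence $(x_n)_{n\ge1}$ there is exactly one $\mu\in\mathrm{eSYM}(D)$ such that $$\mu_b(\{x\})=\lim_{n\to\infty}\mathrm{density}(x,x_n)\qquad\text{for every finite set } b\text{ and every }x\in D_b,$$ and conversely, every $\mu\in\mathrm{eSYM}(D)$ is of this form for some convergent sequence $(x_n)_{n\ge1}$.
   Context: A combinatorial data structure $D$ is a rule mapping every finite set $a$ to a non-empty finite (discrete) set $D_a$ and every injection $\tau:b\to a$ between finite sets to a map $D[\tau]:D_a\to D_b$, with $D[\mathrm{id}_a]=\mathrm{id}_{D_a}$ and $D[\sigma\circ\tau]=D[\tau]\circ D[\sigma]$ for composable injections. For simplicity it is assumed that $a$ can be recovered from $x\in D_a$, so that $|x|:=|a|$ is well defined for $x\in D_a$ (otherwise replace $x\in D_a$ by the pair $(a,x)$). (''Rules'' on all finite sets: NBG with global choice, or inside a fixed Grothendieck universe.) For $x\in D_b$, $y\in D_a$ with $|b|\le|a|$, $$\mathrm{density}(x,y)=\frac{(|a|-|b|)!}{|a|!}\,\big|\{\tau:b\to a\text{ injective}: D[\tau](y)=x\}\big|.$$ A sequence $(x_n)_{n\ge1}$ with $x_n\in D_{a_n}$ ($a_n$ finite sets) is convergent if $|a_n|\to\infty$ and $\lim_{n\to\infty}\mathrm{density}(x,x_n)$ exists for every finite set $b$ and $x\in D_b$; its limit is the rule $x\mapsto\lim_n\mathrm{density}(x,x_n)$. An exchangeable law $\mu$ on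 $D$ is a rule sending every finite set $a$ to a probability measure $\mu_a$ on $D_a$ with $\mu_a\circ D[\tau]^{-1}=\mu_b$ for every injection $\tau:b\to a$. $\mathrm{eSYM}(D)$ is the set of exchangeable laws with the independence property: for all disjoint finite sets $a,b$, $\mu_{a\cup b}\circ(D[\iota_{a,a\cup b}],D[\iota_{b,a\cup b}])^{-1}=\mu_a\otimes\mu_b$, where $\iota$ denotes inclusion maps. *)

(* Defs.v *)
From HB Require Import structures.
From mathcomp Require Import all_boot all_order all_algebra.
From mathcomp Require Import all_classical all_reals all_analysis.

Set Implicit Arguments.
Unset Strict Implicit.
Unset Printing Implicit Defensive.

Import Order.TTheory GRing.Theory Num.Theory.
Import numFieldNormedType.Exports.

Local Open Scope classical_set_scope.
Local Open Scope ring_scope.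

(* "Finite set" is read as [finType], so the universe of [finType] plays the
   role of the fixed Grothendieck universe.  An injection is a finite function
   carrying a boolean proof: injections form a finType (so they can be counted)
   and are equal as soon as they agree pointwise. *)
Definition injection (b a : finType) : Type :=
  {f : {ffun b -> a} | injectiveb f}.

Definition inj_fun (b a : finType) (tau : injection b a) : b -> a := val tau.

Lemma inj_funP (b a : finType) (tau : injection b a) : injective (inj_fun tau).
Proof. exact/injectiveP/(valP tau). Qed.

Lemma finfun_injectiveb (b a : finType) (f : b -> a) :
  injective f -> injectiveb (finfun f).
Proof. by move=> f_inj; apply/injectiveP => u v; rewrite !ffunE => /f_inj. Qed.

Definition mk_injection (b a : finType) (f : b -> a) (f_inj : injective f) :
    injection b a :=
  exist _ (finfun f) (finfun_injectiveb f_inj).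

Definition injection_id (a : finType) : injection a a :=
  mk_injection (@inj_id a).

Definition injection_comp (b a c : finType)
    (sigma : injection a c) (tau : injection b a) : injection b c :=
  mk_injection (inj_comp (@inj_funP _ _ sigma) (@inj_funP _ _ tau)).

Definition injection_inl (a b : finType) : injection a (a + b)%type :=
  mk_injection (@inl_inj a b).

Definition injection_inr (a b : finType) : injection b (a + b)%type :=
  mk_injection (@inr_inj a b).

Record comb_structure := CombStructure {
  ds_carrier : finType -> finType;
  ds_carrier_gt0 : forall a : finType, (0 < #|ds_carrier a|)%N;
  ds_map : forall b a : finType,
    injection b a -> ds_carrier a -> ds_carrier b;
  ds_map_id : forall (a : finType) (y : ds_carrier a),
    ds_map (injection_id a) y = y;
  ds_map_comp : forall (b a c : finType)
    (sigma : injection a c) (tau : injection b a) (z : ds_carrier c),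
    ds_map (injection_comp sigma tau) z = ds_map tau (ds_map sigma z)
}.

Arguments ds_map D {b a} tau y : rename.

(* [ds_obj D a] is the set D_a as a discrete measurable space.  The library's
   measurable spaces are pointed; the point is an arbitrary element and plays
   no role. *)
Definition ds_obj (D : comb_structure) (a : finType) : Type := ds_carrier D a.

HB.instance Definition _ D a := Finite.on (ds_obj D a).

HB.instance Definition _ D a := isPointed.Build (ds_obj D a)
  (enum_val (Ordinal (ds_carrier_gt0 D a))).

HB.instance Definition _ D a := @isMeasurable.Build default_measure_display
  (ds_obj D a) discrete_measurable discrete_measurable0
  (@discrete_measurableC (ds_obj D a)) (@discrete_measurableU (ds_obj D a)).

Definition ds_act (D : comb_structure) (b a : finType) (tau : injection b a) :
    ds_obj D a -> ds_obj D b :=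
  ds_map D tau.

(* If #|a| < #|b| there are no injections and the value is 0. *)
Definition density (R : realType) (D : comb_structure) (b a : finType)
    (x : ds_obj D b) (y : ds_obj D a) : R :=
  ((#|a| - #|b|)`!)%N%:R / (#|a| `!)%N%:R *
    #|[set tau : injection b a | ds_act tau y == x]%SET|%:R.

Definition convergent (R : realType) (D : comb_structure)
    (a_ : nat -> finType) (x_ : forall n, ds_obj D (a_ n)) : Prop :=
  (fun n => #|a_ n|) @ \oo --> \oo /\
  forall (b : finType) (x : ds_obj D b), cvgn (fun n => density R x (x_ n)).

Definition law (R : realType) (D : comb_structure) : Type :=
  forall a : finType, probability (ds_obj D a) R.

Definition exchangeable (R : realType) (D : comb_structure) (mu : law R D) :
    Prop :=
  forall (b a : finType) (tau : injection b a) (A : set (ds_obj D b)),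
    measurable A -> pushforward (mu a) (@ds_act D b a tau) A = mu b A.

(* The union of two disjoint finite sets is their sum type, whose inclusion
   maps are [inl] and [inr]. *)
Definition independence_property (R : realType) (D : comb_structure)
    (mu : law R D) : Prop :=
  forall (a b : finType) (A : set (ds_obj D a * ds_obj D b)%type),
    measurable A ->
    pushforward (mu (a + b)%type)
      (fun z : ds_obj D (a + b)%type =>
         (ds_act (injection_inl a b) z, ds_act (injection_inr a b) z)) A
    = (mu a \x mu b)%E A.

(* A predicate rather than a [set]: [law R D] lives above the universe of
   [set]. *)
Definition eSYM (R : realType) (D : comb_structure) (mu : law R D) : Prop :=
  exchangeable mu /\ independence_property mu.

Definition is_limit_law (R : realType) (D : comb_structure)
    (a_ : nat -> finType) (x_ : forall n, ds_obj D (a_ n)) (mu : law R D) :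
    Prop :=
  forall (b : finType) (x : ds_obj D b),
    mu b [set x] = (limn (fun n => density R x (x_ n)))%:E.

(* Main.v *)
(* Both directions rest on one estimate. For fixed y in D_n, restricting an
   injection a + b -> n to its two summands identifies these injections with the
   pairs of injections a -> n, b -> n that have disjoint images, and almost all
   pairs have disjoint images when #|n| is large. Hence the joint density of
   (x, x') in y differs from density(x, y) * density(x', y) by at most the
   proportion of pairs that are not disjoint, which tends to 0.
   In the limit this gives independence, while exchangeability holds exactly at
   each finite stage, because all fibres of the restriction of injections along
   b -> a have the same size.
   Conversely, if y is drawn from mu_n, the mean of density(x, y) is mu_b {x} and
   the same estimate bounds its variance, so for n large some y in D_n has all
   the densities of structures on at most m points close to those of mu. *)
Require Import Defs.
From mathcomp Require Import all_boot all_order all_algebra.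
From mathcomp Require Import all_classical all_reals all_analysis.
From mathcomp Require Import ring lra.

Set Implicit Arguments.
Unset Strict Implicit.
Unset Printing Implicit Defensive.

Import Order.TTheory GRing.Theory Num.Theory.
Import numFieldNormedType.Exports.

Local Open Scope classical_set_scope.
Local Open Scope ring_scope.

(** * Injections, their number, and fibres of restriction *)

Lemma injection_eqP (b a : finType) (s t : injection b a) :
  inj_fun s =1 inj_fun t -> s = t.
Proof. by move=> st; apply/val_inj/ffunP => i; exact: st. Qed.

Lemma inj_fun_comp (b a c : finType) (s : injection a c) (t : injection b a) i :
  inj_fun (injection_comp s t) i = inj_fun s (inj_fun t i).
Proof. by rewrite {1}/inj_fun /= ffunE. Qed.

Lemma inj_fun_mk (b a : finType) (f : b -> a) (f_inj : injective f) :
  inj_fun (mk_injection f_inj) =1 f.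
Proof. by move=> i; rewrite /inj_fun /= ffunE. Qed.

Lemma ds_act_comp D (b a c : finType) (s : injection a c) (t : injection b a)
    (z : ds_obj D c) :
  ds_act (injection_comp s t) z = ds_act t (ds_act s z).
Proof. exact: ds_map_comp. Qed.

Lemma ds_act_id D (a : finType) (z : ds_obj D a) :
  ds_act (injection_id a) z = z.
Proof. exact: ds_map_id. Qed.

Lemma card_injection (b a : finType) : #|{: injection b a}| = (#|a| ^_ #|b|)%N.
Proof. by rewrite card_sig -card_inj_ffuns cardsE. Qed.

(** The denominator counts all injections, so a density is a proportion. If [#|a| < #|b|], both
    sides vanish because there is nothing to count. *)
Lemma densityE (R : realType) D (b a : finType) (x : ds_obj D b)
    (y : ds_obj D a) :
  density R x y =
  #|[set t : injection b a | ds_act t y == x]%SET|%:R / (#|a| ^_ #|b|)%:R.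
Proof.
rewrite /density mulrC; have [ba|ab] := leqP #|b| #|a|.
  rewrite -(ffact_fact ba) natrM; congr (_ * _).
  by rewrite invfM mulrCA mulfV ?mulr1// pnatr_eq0 -lt0n fact_gt0.
have : #|[set t : injection b a | ds_act t y == x]%SET| = 0%N.
  by apply/eqP; rewrite -leqn0 (leq_trans (max_card _))// card_injection
    ffact_small.
by move->; rewrite !mul0r.
Qed.

(* List both images followed by their complements and match the two lists. *)
Lemma injection_transitive (b a : finType) (r r' : injection b a) :
  exists p : injection a a, injection_comp p r = r'.
Proof.
pose l (q : injection b a) :=
  codom (inj_fun q) ++ [seq i <- enum a | i \notin codom (inj_fun q)].
have l_uniq q : uniq (l q).
  rewrite cat_uniq filter_uniq ?enum_uniq// andbT.
  rewrite (map_inj_uniq (@inj_funP _ _ q)) enum_uniq /=.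
  by apply/hasPn => i; rewrite mem_filter => /andP[].
have l_mem q i : i \in l q.
  by rewrite mem_cat mem_filter mem_enum andbT orbN.
have l_size q : size (l q) = #|a|.
  rewrite cardE; apply/perm_size/uniq_perm; rewrite ?enum_uniq// => i.
  by rewrite l_mem mem_enum.
pose f i := nth i (l r') (index i (l r)).
have f_inj : injective f.
  (* The default of [nth] in [f] depends on the argument; it is made common to [i] and [j] before
     uniqueness of [l r'] is applied. *)
  move=> i j; rewrite /f (set_nth_default i j) ?l_size -1?(l_size r) ?index_mem//.
  move/eqP; rewrite nth_uniq ?l_size -1?(l_size r) ?index_mem// => /eqP ij.
  by rewrite -(nth_index i (l_mem r i)) ij nth_index.
exists (mk_injection f_inj); apply: injection_eqP => i.
rewrite inj_fun_comp inj_fun_mk /f /l.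
rewrite index_cat codom_f nth_cat index_map; last exact: inj_funP.
have ib : (index i (enum b) < size (enum b))%N by rewrite index_mem mem_enum.
by rewrite size_codom cardE ib (nth_map i)// nth_index// mem_enum.
Qed.

(** Composition with a self-injection [p] of [n] carrying one restriction to the other embeds the
    first fibre into the second; symmetry gives equality. *)
Lemma card_fiber (b a n : finType) (t : injection b a) (r r' : injection b n) :
  #|[set s : injection a n | injection_comp s t == r]%SET| =
  #|[set s : injection a n | injection_comp s t == r']%SET|.
Proof.
suff le r1 r2 : (#|[set s : injection a n | injection_comp s t == r1]%SET| <=
    #|[set s : injection a n | injection_comp s t == r2]%SET|)%N.
  by apply/eqP; rewrite eqn_leq !le.
have [p pr] := injection_transitive r1 r2.
rewrite -(card_imset _ (f := injection_comp p)); last first.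
  move=> s s' ss'; apply: injection_eqP => i.
  by apply: (@inj_funP _ _ p); rewrite -!inj_fun_comp ss'.
apply/subset_leq_card/fintype.subsetP => _ /imsetP[s + ->]; rewrite !inE => /eqP st.
apply/eqP; rewrite -pr -st; apply: injection_eqP => i.
by rewrite !inj_fun_comp.
Qed.

(** The restriction of a uniform injection is uniform. The cross-multiplied form also covers the
    case where no injection exists. *)
Lemma card_restriction (b a n : finType) (t : injection b a)
    (P : pred (injection b n)) :
  (#|[set s : injection a n | P (injection_comp s t)]%SET| * #|n| ^_ #|b| =
   #|n| ^_ #|a| * #|[set r | P r]%SET|)%N.
Proof.
have cardE' (Q : pred (injection b n)) (r0 : injection b n) :
    #|[set s : injection a n | Q (injection_comp s t)]%SET| =
    (#|[set r | Q r]%SET| *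
     #|[set s : injection a n | injection_comp s t == r0]%SET|)%N.
  rewrite -[LHS]sum1dep_card (partition_big (fun s => injection_comp s t) Q) //=.
  rewrite (eq_bigr (fun _ =>
    #|[set s : injection a n | injection_comp s t == r0]%SET|)); last first.
    move=> r Qr; rewrite -(card_fiber t r) -sum1dep_card.
    apply: eq_bigl => s; case: eqP => [->|]; rewrite ?Qr ?andbF//.
  by rewrite sum_nat_cond_const cardsE.
have [r0 _|r0] := pickP {: injection b n}; last first.
  have c0 : (#|n| ^_ #|b|)%N = 0%N by rewrite -card_injection eq_card0.
  have -> : #|[set r | P r]%SET| = 0%N.
    by apply/eqP; rewrite -leqn0 -c0 -card_injection max_card.
  by rewrite c0 !muln0.
rewrite (cardE' P r0) -card_injection -[in RHS]card_injection.
(* The trivial predicate expresses the number of all injections [a -> n] through the common fibre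
   size. *)
have := cardE' predT r0; rewrite !cardsT => ->; ring.
Qed.

(** * Densities in one fixed structure: marginals, total mass, approximate independence *)

Lemma density_marginal (R : realType) D (b a n : finType) (t : injection b a)
    (x : ds_obj D b) (y : ds_obj D n) : (#|a| <= #|n|)%N ->
  \sum_(z : ds_obj D a | ds_act t z == x) density R z y = density R x y.
Proof.
move=> an; under eq_bigr do rewrite densityE.
rewrite -mulr_suml -natr_sum densityE.
have ba : (#|b| <= #|a|)%N by exact: leq_card (@inj_funP _ _ t).
apply/eqP; rewrite eqr_div ?pnatr_eq0 -?lt0n ?ffact_gt0 ?(leq_trans ba)//.
rewrite -!natrM eqr_nat mulnC [eqbRHS]mulnC mulnC.
rewrite -(card_restriction t (fun r => ds_act r y == x)) eqn_mul2r.
apply/orP; right; apply/eqP; rewrite -[RHS]sum1dep_card.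
(* Injections [s : a -> n] are sorted by the structure on [a] that they induce from [y]. *)
rewrite (partition_big (fun s : injection a n => ds_act s y)
  (fun z => ds_act t z == x)) /=; last by move=> s; rewrite ds_act_comp.
apply: eq_bigr => z /eqP zx; rewrite -sum1dep_card; apply: eq_bigl => s.
by case: eqP => [sz|]; rewrite ?andbF// ds_act_comp sz zx eqxx.
Qed.

Lemma sum_density (R : realType) D (a n : finType) (y : ds_obj D n) :
  (#|a| <= #|n|)%N -> \sum_(z : ds_obj D a) density R z y = 1.
Proof.
move=> an; under eq_bigr do rewrite densityE.
rewrite -mulr_suml -natr_sum.
suff -> : (\sum_(z : ds_obj D a)
    #|[set t : injection a n | ds_act t y == z]%SET| = #|n| ^_ #|a|)%N.
  by rewrite divff// pnatr_eq0 -lt0n ffact_gt0.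
rewrite -card_injection -sum1_card.
rewrite (partition_big (fun s : injection a n => ds_act s y) predT) //=.
by apply: eq_bigr => z _; rewrite -sum1dep_card.
Qed.

Lemma density_ge0 (R : realType) D (b a : finType) (x : ds_obj D b)
    (y : ds_obj D a) : 0 <= density R x y.
Proof. by rewrite densityE divr_ge0. Qed.

(* The proportion, among pairs of injections from sets of sizes k and l to a set
   of size n, of those whose images meet (1 for n < k + l, by x / 0 = 0). *)
Definition dependence_defect (R : realType) (n k l : nat) : R :=
  1 - (n ^_ (k + l))%:R / ((n ^_ k)%:R * (n ^_ l)%:R).

Lemma density_independence (R : realType) D (a b n : finType)
    (x : ds_obj D a) (x' : ds_obj D b) (y : ds_obj D n) :
  (#|a| + #|b| <= #|n|)%N ->
  `| \sum_(z : ds_obj D (a + b)%type |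
        (ds_act (injection_inl a b) z == x) &&
        (ds_act (injection_inr a b) z == x'))
       density R z y - density R x y * density R x' y |
  <= dependence_defect R #|n| #|a| #|b|.
Proof.
move=> abn.
pose split (r : injection (a + b)%type n) :=
  (injection_comp r (injection_inl a b), injection_comp r (injection_inr a b)).
have split_inj : injective split.
  move=> r r' rr'; apply: injection_eqP => -[i|i].
    have := congr1 (fun s => inj_fun s.1 i) rr'.
    by rewrite !inj_fun_comp inj_fun_mk.
  have := congr1 (fun s => inj_fun s.2 i) rr'.
  by rewrite !inj_fun_comp inj_fun_mk.
have le_split (S : {set injection a n * injection b n}) :
    (#|[set r | split r \in S]%SET| <= #|S|)%N.
  rewrite -(card_imset _ split_inj); apply/subset_leq_card/fintype.subsetP.
  by move=> _ /imsetP[r + ->]; rewrite inE.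
pose S := finset.setX [set s : injection a n | ds_act s y == x]%SET
               [set s : injection b n | ds_act s y == x']%SET.
(* The bound for [S] serves the upper estimate, the one for its complement the lower estimate. *)
have JQ := le_split S; have JQC := le_split (~: S)%SET.
pose J := #|[set r | split r \in S]%SET|.
have PJ : (#|[set r | split r \in (~: S)%SET]%SET| + J = #|n| ^_ (#|a| + #|b|))%N.
  have -> : [set r | split r \in (~: S)%SET]%SET =
     (~: [set r | split r \in S])%SET by apply/setP => r; rewrite !inE.
  by rewrite addnC cardsC card_injection card_sum.
have ABS : (#|(~: S)%SET| + #|S| = #|n| ^_ #|a| * #|n| ^_ #|b|)%N.
  by rewrite addnC cardsC card_prod !card_injection.
have -> : \sum_(z : ds_obj D (a + b)%type |
      (ds_act (injection_inl a b) z == x) &&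
      (ds_act (injection_inr a b) z == x'))
    density R z y = J%:R / (#|n| ^_ (#|a| + #|b|))%:R.
  under eq_bigr do rewrite densityE card_sum.
  rewrite -mulr_suml -natr_sum; congr (_%:R / _).
  rewrite /J -[RHS]sum1dep_card.
  rewrite (partition_big (fun r : injection (a + b)%type n => ds_act r y)
    (fun z => (ds_act (injection_inl a b) z == x) &&
              (ds_act (injection_inr a b) z == x')))
    /=; last by move=> r; rewrite !inE !ds_act_comp.
  apply: eq_bigr => z /andP[zx zx']; rewrite -sum1dep_card; apply: eq_bigl => r.
  rewrite !inE !ds_act_comp; case: eqP => [rz|]; rewrite ?andbF//.
  by rewrite rz zx zx'.
rewrite !densityE mulrACA -invfM -natrM -cardsX -/S /dependence_defect.
rewrite -!natrM -ABS -PJ; rewrite -/J in JQ.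
(* What remains is arithmetic with [J <= Q] and [J' <= Q']: the ratio J/(J'+J) exceeds Q/(Q'+Q) by
   at most J/(J'+J) times 1 - (J'+J)/(Q'+Q), and the lower bound is the same inequality for the
   complementary ratios. *)
move: #|[set r | _]%SET| #|(~: S)%SET| #|S| J JQ JQC PJ ABS.
move=> J' Q' Q J JQ JQC PJ ABS.
have P0 : (0 < J' + J)%N by rewrite PJ ffact_gt0.
have A0 : (0 < Q' + Q)%N by rewrite (leq_trans P0)// leq_add.
rewrite !natrD {PJ ABS}.
have {}P0 : 0 < J'%:R + J%:R :> R by rewrite -natrD ltr0n.
have {}A0 : 0 < Q'%:R + Q%:R :> R by rewrite -natrD ltr0n.
have {}JQ : J%:R <= Q%:R :> R by rewrite ler_nat.
have {}JQC : J'%:R <= Q'%:R :> R by rewrite ler_nat.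
have J0 : 0 <= J%:R :> R by [].
have J'0 : 0 <= J'%:R :> R by [].
move: (J%:R : R) (J'%:R : R) (Q%:R : R) (Q'%:R : R) P0 A0 JQ JQC J0 J'0.
move=> {}J {}J' {}Q {}Q' P0 A0 JQ JQC J0 J'0.
have AP : (Q' + Q)^-1 <= (J' + J)^-1 by rewrite lef_pV2 ?posrE// lerD.
have eP : (J' + J) / (J' + J) = 1 by rewrite divff// gt_eqF.
have eA : (Q' + Q) / (Q' + Q) = 1 by rewrite divff// gt_eqF.
have iA : 0 <= (Q' + Q)^-1 by rewrite invr_ge0 ltW.
rewrite ler_norml; move: (_^-1) (_^-1) AP eP eA iA => u v AP eP eA iA.
apply/andP; split; nra.
Qed.

(** * Probability measures on finite discrete spaces *)

Lemma measure_seq d (T : measurableType d) (R : realType)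
    (m : {measure set T -> \bar R}) (r : seq T) :
  (forall x : T, measurable [set x]) -> uniq r ->
  m [set` r] = (\sum_(x <- r) m [set x])%E.
Proof.
move=> mT r_uniq; rewrite fsbig_seq// -measure_fin_bigcup//; last first.
  by move=> x y _ _ [z [-> ->]].
by congr (m _); apply/seteqP; split => [x xr|x [y yr ->]//]; exists x.
Qed.

Lemma probability_finite (R : realType) D (a : finType)
    (m : probability (ds_obj D a) R) (P : pred (ds_obj D a)) :
  m [set x | P x] = (\sum_(x | P x) fine (m [set x]))%:E.
Proof.
have -> : [set x | P x] = [set` enum P].
  by apply/seteqP; split => x; rewrite /= mem_enum.
rewrite measure_seq ?enum_uniq// big_enum -sumEFin; apply: eq_bigr => x _.
by rewrite fineK// fin_num_measure.
Qed.

(** A [probability] bundles a set function with proofs of its axioms; proof irrelevance identifies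
    the bundles. Uniqueness of the limit law, an equality of such bundles, rests on this. *)
Lemma probability_eq d (T : measurableType d) (R : realType)
    (m m' : probability T R) : (m : set T -> \bar R) = m' -> m = m'.
Proof.
case: m m' => [f [[a1 a2] [a3] [b] [c] [e] [g] [h]]].
case=> [f' [[a1' a2'] [a3'] [b'] [c'] [e'] [g'] [h']]] /= ff'.
rewrite -{}ff' in a1' a2' a3' b' c' e' g' h' *.
rewrite (Prop_irrelevance a1' a1) (Prop_irrelevance a2' a2).
rewrite (Prop_irrelevance a3' a3) (Prop_irrelevance b' b).
rewrite (Prop_irrelevance c' c) (Prop_irrelevance e' e).
by rewrite (Prop_irrelevance g' g) (Prop_irrelevance h' h).
Qed.

Lemma probability_ext (R : realType) D (a : finType)
    (m m' : probability (ds_obj D a) R) :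
  (forall x, m [set x] = m' [set x]) -> m = m'.
Proof.
move=> mm'; apply: probability_eq; apply/funext => A.
rewrite (_ : A = [set x | x \in A]); last first.
  by apply/seteqP; split => x; rewrite /= inE.
by rewrite !probability_finite; under eq_bigr do rewrite mm'.
Qed.

Lemma probability_of_weights (R : realType) D (a : finType)
    (w : ds_obj D a -> R) :
  (forall x, 0 <= w x) -> \sum_x w x = 1 ->
  exists m : probability (ds_obj D a) R, forall x, m [set x] = (w x)%:E.
Proof.
move=> w0 w1.
pose s := enum {: ds_obj D a}.
pose delta x := mscale (NngNum (w0 x)) (@dirac _ (ds_obj D a) x R).
pose m0 : {measure set (ds_obj D a) -> \bar R} :=
  msum (fun k => delta (nth point s k)) (size s).
have m0E A : m0 A = (\sum_(x | x \in A) w x)%:E.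
  rewrite /m0 /= /msum -(big_mkord predT (fun k => delta (nth point s k) A)).
  rewrite -(big_nth point predT (fun x => delta x A)).
  rewrite big_enum /= -sumEFin [RHS]big_mkcond /=; apply: eq_bigr => x _.
  by rewrite /delta /mscale /= diracE; case: ifP; rewrite ?mule1 ?mule0.
have m0T : m0 setT = 1%:E.
  by rewrite m0E -w1; congr (_%:E); apply: eq_bigl => x; rewrite in_setT.
(* As [m0] has total mass 1, normalizing leaves its values unchanged and supplies the [probability]
   structure. *)
exists (mnormalize m0 (dirac point)) => x.
rewrite /= /mnormalize m0T onee_eq0 /= invr1 mule1 m0E.
by rewrite (big_pred1 x)// => y; rewrite in_set1.
Qed.


(** * Laws described by their point masses *)

Definition mass (R : realType) D (mu : law R D) (a : finType)
    (x : ds_obj D a) : R := fine (mu a [set x]).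

Lemma mass_ge0 (R : realType) D (mu : law R D) (a : finType) (x : ds_obj D a) :
  0 <= mass mu x.
Proof. exact/fine_ge0/measure_ge0. Qed.

Lemma massE (R : realType) D (mu : law R D) (a : finType) (x : ds_obj D a) :
  mu a [set x] = (mass mu x)%:E.
Proof. by rewrite /mass fineK// fin_num_measure. Qed.

Lemma law_finite (R : realType) D (mu : law R D) (a : finType)
    (A : set (ds_obj D a)) : mu a A = (\sum_(x | x \in A) mass mu x)%:E.
Proof.
rewrite -probability_finite; congr (mu a _).
by apply/seteqP; split => x; rewrite /= inE.
Qed.

Lemma sum_mass (R : realType) D (mu : law R D) (a : finType) :
  \sum_(x : ds_obj D a) mass mu x = 1.
Proof.
apply: EFin_inj; rewrite -[RHS](probability_setT (mu a)) law_finite.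
by congr (_%:E); apply: eq_bigl => x; rewrite in_setT.
Qed.

(** Finite additivity reduces all events to single points. The resulting sum has the shape of
    [density_marginal]. *)
Lemma exchangeableP (R : realType) D (mu : law R D) :
  exchangeable mu <->
  forall (b a : finType) (t : injection b a) (x : ds_obj D b),
    \sum_(z | ds_act t z == x) mass mu z = mass mu x.
Proof.
split=> [ex b a t x|ex b a t A _]; rewrite ?/pushforward.
  apply: EFin_inj; rewrite -massE -(ex b a t)// /pushforward law_finite.
  by congr (_%:E); apply: eq_bigl => z; apply/eqP/idP; rewrite inE.
rewrite !law_finite (partition_big (ds_act t) (fun x => x \in A)) /=; last first.
  by move=> z; rewrite !inE.
congr (_%:E); apply: eq_bigr => x xA; rewrite -(ex b a t); apply: eq_bigl => z.
case: eqP => [zx|]; rewrite ?andbF// andbT.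
by apply/idP; move: xA; rewrite !inE /= zx.
Qed.

Lemma product_measure_finite (R : realType) D (mu : law R D) (a b : finType)
    (A : set (ds_obj D a * ds_obj D b)) :
  (mu a \x mu b)%E A = (\sum_(u | u \in A) mass mu u.1 * mass mu u.2)%:E.
Proof.
(* Points are rectangles, which makes them measurable for the product sigma-algebra and gives their
   product measure. *)
have uE (u : ds_obj D a * ds_obj D b) : [set u] = [set u.1] `*` [set u.2].
  by case: u => x y; apply/seteqP; split => -[x' y'] /= => -[-> ->].
have -> : A = [set` enum (fun u => u \in A)].
  by apply/seteqP; split => u; rewrite /= mem_enum inE.
rewrite measure_seq ?enum_uniq//; last by move=> u; rewrite uE; exact: measurableX.
rewrite big_enum -sumEFin /=; apply: eq_big => [u|u _].
  by apply/idP/idP; rewrite !inE /= mem_enum inE.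
by rewrite uE product_measure1E// EFinM -!massE.
Qed.

(** Again a reduction to points; the sum is the one estimated in [density_independence]. *)
Lemma independence_propertyP (R : realType) D (mu : law R D) :
  independence_property mu <->
  forall (a b : finType) (x : ds_obj D a) (x' : ds_obj D b),
    \sum_(z : ds_obj D (a + b)%type |
       (ds_act (injection_inl a b) z == x) &&
       (ds_act (injection_inr a b) z == x'))
      mass mu z = mass mu x * mass mu x'.
Proof.
split=> [ind a b x x'|ind a b A _].
  apply: EFin_inj.
  have mA : measurable [set (x, x')].
    rewrite (_ : [set (x, x')] = [set x] `*` [set x']); first exact: measurableX.
    by apply/seteqP; split => -[y y'] /= => -[-> ->].
  have := ind a b _ mA; rewrite product_measure_finite (big_pred1 (x, x'))/=; last first.
    by move=> u; rewrite in_set1.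
  move=> <-; rewrite /pushforward law_finite; congr (_%:E); apply: eq_bigl => z.
  by rewrite -xpair_eqE; apply/eqP/idP; rewrite inE.
rewrite product_measure_finite /pushforward law_finite.
pose f (z : ds_obj D (a + b)%type) :=
  (ds_act (injection_inl a b) z, ds_act (injection_inr a b) z).
rewrite (partition_big f (fun u => u \in A)) /=; last by move=> z; rewrite !inE.
congr (_%:E); apply: eq_bigr => -[x x'] xA; rewrite -ind; apply: eq_bigl => z.
rewrite -xpair_eqE -/(f z); case: eqP => [zx|]; rewrite ?andbF// andbT.
by apply/idP; move: xA; rewrite !inE -zx.
Qed.

(** * Asymptotics of falling factorials *)

Lemma cvg_sumr (R : realType) (I : finType) (P : pred I) (u : I -> nat -> R)
    (l : I -> R) :
  (forall i, P i -> u i n @[n --> \oo] --> l i) ->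
  \sum_(i | P i) u i n @[n --> \oo] --> \sum_(i | P i) l i.
Proof. by apply: cvg_big => x; exact: add_continuous. Qed.

(** Passing from [k] to [k.+1] multiplies the ratio by (n - k)/n = 1 - k/n, which tends to 1. *)
Lemma cvg_ffact_ratio (R : realType) (k : nat) :
  ((n ^_ k)%:R / n%:R ^+ k : R) @[n --> \oo] --> (1 : R).
Proof.
elim: k => [|k IH].
  by apply: cvg_near_cst; near=> n; rewrite ffactn0 expr0 divr1.
have V0 : (n%:R^-1 : R) @[n --> \oo] --> (0 : R).
  apply/gtr0_cvgV0; last exact: cvgr_idn.
  by near=> n; rewrite ltr0n; near: n; exact: nbhs_infty_ge.
have : (n ^_ k)%:R / n%:R ^+ k * (1 - k%:R * n%:R^-1) @[n --> \oo] -->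
    (1 * (1 - k%:R * 0) : R).
  by apply: cvgM => //; apply: cvgB; [exact: cvg_cst|exact: cvgMr].
rewrite mulr0 subr0 mulr1; apply: cvg_trans; apply: near_eq_cvg; near=> n.
have kn : (k < n)%N by near: n; exact: nbhs_infty_ge.
rewrite ffactnSr natrM natrB 1?ltnW// exprSr invfM mulrACA; congr (_ * _).
by rewrite mulrBl divff// pnatr_eq0 -lt0n (leq_ltn_trans _ kn).
Unshelve. all: by end_near. Qed.

Lemma cvg_dependence_defect (R : realType) (k l : nat) :
  dependence_defect R n k l @[n --> \oo] --> (0 : R).
Proof.
have F := @cvg_ffact_ratio R.
(* Each falling factorial is compared with the power of [n] of the same degree; the powers
   cancel. *)
have : 1 - (n ^_ (k + l))%:R / n%:R ^+ (k + l) /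
    ((n ^_ k)%:R / n%:R ^+ k * ((n ^_ l)%:R / n%:R ^+ l))
    @[n --> \oo] --> (1 - 1 / (1 * 1) : R).
  apply: cvgB; first exact: cvg_cst.
  apply: cvgM; first exact: F.
  apply: cvgV; rewrite ?mulr1 ?oner_eq0//.
  by rewrite -[X in _ --> X]mulr1; apply: cvgM; exact: F.
rewrite mulr1 divr1 subrr; apply: cvg_trans; apply: near_eq_cvg; near=> n.
have n0 : n%:R != 0 :> R.
  by rewrite pnatr_eq0 -lt0n; near: n; exact: nbhs_infty_ge.
rewrite /dependence_defect mulrACA -invfM -exprD !invfM invrK; congr (1 - _).
by rewrite mulrACA mulVf ?mulr1// expf_neq0.
Unshelve. all: by end_near. Qed.

(** Enumerating [b] reduces all finite sets to the countably many ['I_k], so that each stage of the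
    later construction has only finitely many densities to control. *)
Lemma density_relabel (R : realType) D (b : finType) :
  exists f : injection 'I_#|b| b,
    injective (ds_act f : ds_obj D b -> _) /\
    forall (n : finType) (x : ds_obj D b) (y : ds_obj D n),
      (#|b| <= #|n|)%N -> density R x y = density R (ds_act f x) y.
Proof.
exists (mk_injection (@enum_val_inj _ b)); set f := mk_injection _.
have f_inj : injective (ds_act f : ds_obj D b -> _).
  apply: (@can_inj _ _ _ (ds_act (mk_injection (@enum_rank_inj b)))) => x.
  rewrite -ds_act_comp -[RHS]ds_act_id; congr ds_act.
  by apply: injection_eqP => i; rewrite inj_fun_comp !inj_fun_mk enum_rankK.
split=> // n x y bn; rewrite -(density_marginal R f _ _ bn).
by rewrite (big_pred1 x)// => z; rewrite (inj_eq f_inj).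
Qed.

(** * Limits of convergent sequences are laws in [eSYM] *)

Lemma limit_law (R : realType) D (a_ : nat -> finType)
    (x_ : forall n, ds_obj D (a_ n)) :
  convergent R x_ -> exists mu : law R D, eSYM mu /\ is_limit_law x_ mu.
Proof.
move=> [a_oo x_cvg].
(* The finite-stage identities require the small set to fit into [a_ n], hence hold only
   eventually. *)
have large k : \forall n \near \oo, (k <= #|a_ n|)%N.
  by move/cvgnyPge : a_oo; exact.
pose w (b : finType) (x : ds_obj D b) : R := limn (fun n => density R x (x_ n)).
have wP (b : finType) (x : ds_obj D b) :
  density R x (x_ n) @[n --> \oo] --> w b x by exact: x_cvg.
have limU (u : nat -> R) (l l' : R) :
    u n @[n --> \oo] --> l -> u n @[n --> \oo] --> l' -> l = l'.
  by move=> ul; apply: cvg_unique ul; exact: norm_hausdorff.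
have w_prob (b : finType) : exists m : probability (ds_obj D b) R,
    forall x, m [set x] = (w b x)%:E.
  apply: probability_of_weights => [x|].
    by apply: limr_ge => //; near=> n; exact: density_ge0.
  have /limU := cvg_sumr (P := predT) (fun x _ => wP b x); apply.
  apply: cvg_near_cst; near=> n; rewrite sum_density//.
  by near: n; exact: large.
pose mu (b : finType) := projT1 (cid (w_prob b)).
have muE b x : mu b [set x] = (w b x)%:E by rewrite /mu; case: cid.
have mass_mu (b : finType) (x : ds_obj D b) : mass mu x = w b x.
  by rewrite /mass muE.
exists mu; split; last by move=> b x; rewrite muE.
split; [apply/exchangeableP => b a t x|apply/independence_propertyP => a b x x'].
  rewrite mass_mu; under eq_bigr do rewrite mass_mu.
  have /limU := cvg_sumr (P := fun z => ds_act t z == x) (fun z _ => wP a z).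
  apply; apply: cvg_trans (wP b x); apply: near_eq_cvg; near=> n.
  by rewrite -(density_marginal R t)//; near: n; exact: large.
rewrite !mass_mu; under eq_bigr do rewrite mass_mu.
apply/eqP; rewrite -subr_eq0; apply/eqP.
pose P (z : ds_obj D (a + b)%type) :=
  (ds_act (injection_inl a b) z == x) && (ds_act (injection_inr a b) z == x').
(* The difference of joint and product densities tends to the difference of the masses, and also to
   0, being squeezed by the defect. *)
apply: (limU _ _ _ (cvgB (cvg_sumr (P := P) (fun z _ => wP _ z))
                         (cvgM (wP a x) (wP b x')))).
apply: norm_cvg0.
apply: (squeeze_cvgr (f := cst 0)
  (h := fun n => dependence_defect R #|a_ n| #|a| #|b|)).
- near=> n; rewrite normr_ge0 /=; apply: density_independence.
  by near: n; exact: large.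
- exact: cvg_cst.
- exact: (cvg_comp _ _ a_oo (cvg_dependence_defect _ _)).
Unshelve. all: by end_near. Qed.

Lemma is_limit_law_unique (R : realType) D (a_ : nat -> finType)
    (x_ : forall n, ds_obj D (a_ n)) (mu mu' : law R D) :
  is_limit_law x_ mu -> is_limit_law x_ mu' -> mu = mu'.
Proof.
move=> h h'; apply: functional_extensionality_dep => b.
by apply: probability_ext => x; rewrite h h'.
Qed.

(** * Realizing a law by sampling *)

Lemma mean_density (R : realType) D (mu : law R D) (b n : finType)
    (x : ds_obj D b) : exchangeable mu -> (#|b| <= #|n|)%N ->
  \sum_(y : ds_obj D n) mass mu y * density R x y = mass mu x.
Proof.
move=> /exchangeableP ex bn.
under eq_bigr do rewrite densityE mulrA.
rewrite -mulr_suml.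
under eq_bigr => y _.
  rewrite -sum1dep_card natr_sum mulr_sumr big_mkcond /=.
  over.
(* For each fixed injection [t], exchangeability gives the event [ds_act t y == x] probability
   [mass mu x]; averaging over [t] keeps this value. *)
rewrite exchange_big /=.
under eq_bigr => t _.
  under eq_bigr do rewrite mulr1.
  rewrite -big_mkcond ex.
  over.
rewrite sumr_const card_injection -[_ *+ _]mulr_natr mulfK//.
by rewrite pnatr_eq0 -lt0n ffact_gt0.
Qed.

Lemma second_moment_density (R : realType) D (mu : law R D) (b n : finType)
    (x : ds_obj D b) : eSYM mu -> (#|b| + #|b| <= #|n|)%N ->
  \sum_(y : ds_obj D n) mass mu y * (density R x y - mass mu x) ^+ 2 <=
  dependence_defect R #|n| #|b| #|b|.
Proof.
move=> [ex ind] bbn.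
pose P (z : ds_obj D (b + b)%type) :=
  (ds_act (injection_inl b b) z == x) && (ds_act (injection_inr b b) z == x).
pose J (y : ds_obj D n) := \sum_(z | P z) density R z y.
set e := dependence_defect _ _ _ _; set m := mass mu x.
have JE : \sum_y mass mu y * J y = m ^+ 2.
  under eq_bigr do rewrite mulr_sumr.
  rewrite exchange_big /=; under eq_bigr do rewrite mean_density ?card_sum//.
  by rewrite (independence_propertyP mu).1.
have dE : \sum_(y : ds_obj D n) mass mu y * density R x y = m.
  by rewrite mean_density// (leq_trans (leq_addr _ _) bbn).
(* Pointwise, the squared density is at most [J y + e]. As [J] has mean [m ^+ 2] and the density has
   mean [m], the resulting bound on the squared deviation has mean exactly [e]. *)
have -> : e = \sum_y mass mu y * (J y + e - 2 * m * density R x y + m ^+ 2).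
  under eq_bigr do rewrite mulrDr mulrBr mulrDr (mulrCA (mass mu _)).
  rewrite !big_split/= sumrN -mulr_sumr -!mulr_suml JE dE sum_mass; ring.
apply: ler_sum => y _; apply: ler_wpM2l; first exact: mass_ge0.
have := density_independence R x x y bbn.
rewrite ler_norml -/e -/(J y) => /andP[h _].
by rewrite sqrrB; lra.
Qed.

Lemma exists_le_mean (R : realType) (I : finType) (i0 : I) (p s : I -> R)
    (c : R) :
  (forall i, 0 <= p i) -> \sum_i p i = 1 -> \sum_i p i * s i <= c ->
  exists i, s i <= c.
Proof.
move=> p0 p1 sc; case: (@arg_minP _ _ _ i0 predT s isT) => i _ s_min.
exists i; apply: le_trans sc; rewrite -[leLHS]mul1r -p1 mulr_suml.
by apply: ler_sum => j _; rewrite ler_wpM2l// s_min.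
Qed.

(** The squared errors over all structures on ['I_k], [k <= m], form a finite sum whose mean tends
    to 0. Some [y] does no worse than the mean, and each nonnegative term is at most the sum. *)
Lemma good_sample (R : realType) D (mu : law R D) (m : nat) :
  eSYM mu -> exists s : {n & ds_obj D 'I_n}, (m <= projT1 s)%N /\
    forall k (x : ds_obj D 'I_k), (k <= m)%N ->
      (density R x (projT2 s) - mass mu x) ^+ 2 <= m.+1%:R^-1.
Proof.
move=> mu_sym.
have : \sum_(k < m.+1) \sum_(x : ds_obj D 'I_k) dependence_defect R n k k
    @[n --> \oo] --> (0 : R).
  rewrite [X in _ --> X](_ : _ =
    \sum_(k < m.+1) \sum_(x : ds_obj D 'I_k) 0); last first.
    by rewrite big1// => k _; rewrite big1.
  by apply: cvg_sumr => k _; apply: cvg_sumr => x _; exact: cvg_dependence_defect.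
move=> /cvgr0_norm_le /(_ m.+1%:R^-1); rewrite invr_gt0 ltr0n => /(_ isT) small.
(* The bound [m + m <= n] leaves room for two copies of any ['I_k] with [k <= m], as the second
   moment estimate demands. *)
have : \forall n \near \oo, (m + m <= n)%N /\
    `|\sum_(k < m.+1) \sum_(x : ds_obj D 'I_k) dependence_defect R n k k|
      <= m.+1%:R^-1.
  by near=> n; split; near: n; [exact: nbhs_infty_ge|exact: small].
move=> /filter_ex[n [mn /(le_trans (ler_norm _)) {}small]].
pose s (y : ds_obj D 'I_n) := \sum_(k < m.+1) \sum_(x : ds_obj D 'I_k)
  (density R x y - mass mu x) ^+ 2.
have [|y sy] := @exists_le_mean R (ds_obj D 'I_n) point (mass mu (a := 'I_n))
  s m.+1%:R^-1 (@mass_ge0 _ _ mu _) (sum_mass mu _).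
  apply: le_trans small.
  under eq_bigr do rewrite mulr_sumr; rewrite exchange_big /=.
  apply: ler_sum => k _.
  under eq_bigr do rewrite mulr_sumr; rewrite exchange_big /=.
  apply: ler_sum => x _.
  have := second_moment_density (n := 'I_n) x mu_sym; rewrite !card_ord; apply.
  by apply: leq_trans mn; rewrite leq_add// -ltnS.
exists (existT _ n y); split; first exact: leq_trans (leq_addr _ _) mn.
move=> k x; rewrite -ltnS => km; apply: le_trans sy; rewrite /s.
rewrite (bigD1 (Ordinal km))//= (bigD1 x)//= -addrA lerDl addr_ge0//.
  by apply: sumr_ge0 => *; exact: sqr_ge0.
by apply: sumr_ge0 => *; apply: sumr_ge0 => *; exact: sqr_ge0.
Unshelve. all: by end_near. Qed.

Lemma law_is_limit (R : realType) D (mu : law R D) : eSYM mu ->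
  exists (a_ : nat -> finType) (x_ : forall n, ds_obj D (a_ n)),
    convergent R x_ /\ is_limit_law x_ mu.
Proof.
move=> mu_sym.
have [s sP] := choice (fun m => good_sample m mu_sym).
pose N m := projT1 (s m); pose x_ m : ds_obj D 'I_(N m) := projT2 (s m).
have mN m : (m <= N m)%N := (sP m).1.
have x_close m k (x : ds_obj D 'I_k) : (k <= m)%N ->
    (density R x (x_ m) - mass mu x) ^+ 2 <= m.+1%:R^-1 by exact: (sP m).2.
have cvg_ord k (x : ds_obj D 'I_k) :
    density R x (x_ m) @[m --> \oo] --> mass mu x.
  apply/cvgrPdistC_lt => e e0; near=> m.
  (* Once [m >= k], the squared error is at most 1/(m+1), which is eventually below [e ^+ 2]. *)
  rewrite -ltr_sqr ?nnegrE ?normr_ge0 ?ltW// real_normK ?num_real//.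
  apply: le_lt_trans (x_close m k x _) _; first by near: m; exact: nbhs_infty_ge.
  near: m; have /cvgr0_norm_lt := @cvg_harmonic R.
  move=> /(_ (e ^+ 2)); rewrite exprn_gt0// => /(_ isT).
  by apply: filterS => m /=; rewrite ger0_norm.
have cvg_all (b : finType) (x : ds_obj D b) :
    density R x (x_ m) @[m --> \oo] --> mass mu x.
  have [f [f_inj fE]] := density_relabel R D b.
  (* Exchangeability along the bijection [f] transfers masses just as [fE] transfers densities. *)
  have -> : mass mu x = mass mu (ds_act f x).
    have /exchangeableP ex := mu_sym.1; rewrite -(ex _ _ f).
    by rewrite (big_pred1 x)// => z; rewrite (inj_eq f_inj).
  apply: cvg_trans (cvg_ord _ (ds_act f x)); apply: near_eq_cvg; near=> m.
  rewrite fE// card_ord (leq_trans _ (mN m))//.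
  by near: m; exact: nbhs_infty_ge.
exists (fun m => 'I_(N m)), x_; split; last first.
  by move=> b x; rewrite massE (cvg_lim _ (cvg_all b x)).
split=> [|b x]; last by apply/cvg_ex; exists (mass mu x); exact: cvg_all.
apply/cvgnyPge => k; near=> m; rewrite card_ord (leq_trans _ (mN m))//.
by near: m; exact: nbhs_infty_ge.
Unshelve. all: by end_near. Qed.

Theorem theorem9 (R : realType) (D : comb_structure) :
  (forall (a_ : nat -> finType) (x_ : forall n : nat, ds_obj D (a_ n)),
      convergent R x_ ->
      exists! mu : law R D, eSYM mu /\ is_limit_law x_ mu) /\
  (forall mu : law R D, eSYM mu ->
      exists (a_ : nat -> finType) (x_ : forall n : nat, ds_obj D (a_ n)),
        convergent R x_ /\ is_limit_law x_ mu).
Proof.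
split=> [a_ x_ x_cvg|]; last exact: law_is_limit.
have [mu [mu_sym mu_lim]] := limit_law x_cvg.
by exists mu; split=> // mu' [_]; exact: is_limit_law_unique.
Qed.
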